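(* Let $k^*, k_1, \dots, k_s$ be positive integers ($s \ge 0$ an integer). Let $G$ be the vertex-disjoint union of the graphs ${_*C}^{k^*}, {_1C}^{k_1}, \dots, {_sC}^{k_s}$, where ${_*C}, {_1C}, \dots, {_sC}$ are cycles. Suppose that $1 \leq r \leq \alpha(G)$ and that $$\omega({_iC}^{k_i}) > 2k^* + 1 \quad \text{for every } i \in \{1,\dots,s\}.$$ Then $G$ is $r$-EKR. Moreover, for any vertex $x$ of ${_*C}$, the star ${\mathcal{I}_G}^{(r)}(x)$ is a largest intersecting subfamily of ${\mathcal{I}_G}^{(r)}$.
   Context: All graphs are finite and simple. For $n\ge3$, $C_n$ is the graph on $\{1,\dots,n\}$ with edges $\{i,i+1\}$ ($1\le i\le n-1$) and $\{n,1\}$; a cycle is a copy of some $C_n$. For a graph $G$ and $k\ge1$, the $k$-th power $G^k$ has vertex set $V(G)$ and edge set $\{vw : 1 \le d_G(v,w)\le k\}$, where $d_G$ is graph distance. A graph is the (vertex-)disjoint union of graphs with pairwise disjoint vertex sets if its vertex set and edge set are the unions of theirs. An independent set of $G$ is a set of pairwise non-adjacent vertices; ${\mathcal{I}_G}^{(r)}$ is the family of independent sets of $G$ of size $r$. $\alpha(G)$ is the maximum size of an independent set and $\omega(G)$ is the maximum size of a clique. A family of sets is intersecting if every two of its members have nonempty intersection. For a family $\mathcal{F}$ and a vertex $x$, the star $\mathcal{F}(x)$ is $\{A\in\mathcal{F} : x\in A\}$. $G$ is $r$-EKR if at least one of the largest intersecting subfamilies of ${\mathcal{I}_G}^{(r)}$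 is a star of ${\mathcal{I}_G}^{(r)}$. *)

(* Defs.v *)
From mathcomp Require Import all_boot.

Set Implicit Arguments.
Unset Strict Implicit.
Unset Printing Implicit Defensive.

(* The vertex set is an arbitrary subset of an ambient finite type, so that
   several graphs can be compared and united inside the same type. *)
Record sgraph (T : finType) := SGraph {
  vset : {set T};
  adj : rel T;
  adj_sym : symmetric adj;
  adj_irr : irreflexive adj;
  adj_vset : forall x y, adj x y -> x \in vset }.

Section Graphs.
Variable T : finType.
Implicit Types (G : sgraph T) (A B : {set T}) (F : {set {set T}}).

Definition walk G (d : nat) (x y : T) : bool :=
  [exists p : d.-tuple T, path (adj G) x p && (last x p == y)].

(* The smallest length of a walk, or None when there is no walk; a shortest
   walk has length less than #|T|. *)
Definition dist G (x y : T) : option nat :=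
  let d := find (fun d => walk G d x y) (iota 0 #|T|) in
  if d < #|T| then Some d else None.

Lemma walkP G d x y :
  reflect (exists p : seq T, [/\ size p = d, path (adj G) x p & last x p = y])
          (walk G d x y).
Proof.
apply: (iffP existsP) => [[p /andP[pp /eqP pl]]|[p [sp pp pl]]].
  by exists p; rewrite size_tuple.
have sp' : size p == d by apply/eqP.
by exists (Tuple sp'); rewrite /= pp pl eqxx.
Qed.

Lemma walk_sym G d x y : walk G d x y = walk G d y x.
Proof.
apply/idP/idP => /walkP[p [sp pp pl]]; apply/walkP.
  exists (rev (belast x p)); split.
  - by rewrite size_rev size_belast.
  - rewrite -pl rev_path (eq_path (e' := adj G)) // => a b; exact: adj_sym.
  - by case: p pl {sp pp} => //= a p _; rewrite rev_cons last_rcons.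
exists (rev (belast y p)); split.
- by rewrite size_rev size_belast.
- rewrite -pl rev_path (eq_path (e' := adj G)) // => a b; exact: adj_sym.
- by case: p pl {sp pp} => //= a p _; rewrite rev_cons last_rcons.
Qed.

Lemma walk_short G d x y :
  walk G d x y -> exists2 d', walk G d' x y & (d' <= d) && (d' < #|T|).
Proof.
move=> /walkP[p [sp pp pl]].
case: (shortenP pp) pl => p' pp' up' sub pl'.
exists (size p'); first by apply/walkP; exists p'.
rewrite -sp; apply/andP; split.
  by apply: uniq_leq_size => //; case/andP: up'.
by rewrite -[(size p').+1]/(size (x :: p')) -(card_uniqP up') max_card.
Qed.

Lemma distP G x y d :
  dist G x y = Some d <->
  walk G d x y /\ (forall d', walk G d' x y -> d <= d').
Proof.
rewrite /dist; set a := fun d => walk G d x y.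
split.
  case: ifP => // lt [<-].
  have h : has a (iota 0 #|T|) by rewrite has_find size_iota.
  split; first by have := nth_find 0 h; rewrite nth_iota.
  move=> d' /walk_short[d'' w /andP[le1 lt1]]; apply: leq_trans le1.
  rewrite leqNgt; apply/negP => lt2.
  by have := before_find 0 lt2; rewrite nth_iota // /a w.
case=> w mn.
have [d' w' /andP[le1 lt1]] := walk_short w.
have ltd : d < #|T| by apply: leq_ltn_trans lt1; apply: mn.
have -> : find a (iota 0 #|T|) = d; last by rewrite ltd.
have h : has a (iota 0 #|T|).
  by apply/hasP; exists d => //; rewrite mem_iota.
apply/eqP; rewrite eqn_leq; apply/andP; split.
  rewrite leqNgt; apply/negP => lt2.
  by have := before_find 0 lt2; rewrite nth_iota // /a w.
apply: mn.
by have := nth_find 0 h; rewrite nth_iota // -[X in _ < X](size_iota 0) -has_find.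
Qed.

Definition gpower_adj G (k : nat) : rel T :=
  fun x y => if dist G x y is Some d then 1 <= d <= k else false.

Lemma gpower_sym G k : symmetric (gpower_adj G k).
Proof.
move=> x y; rewrite /gpower_adj /dist.
by rewrite (eq_find (a2 := fun d => walk G d y x)) // => d; apply: walk_sym.
Qed.

Lemma gpower_irr G k : irreflexive (gpower_adj G k).
Proof.
move=> x; rewrite /gpower_adj.
suff -> : dist G x x = Some 0 by [].
by apply/distP; split=> //; apply/walkP; exists [::].
Qed.

Lemma gpower_vset G k x y : gpower_adj G k x y -> x \in vset G.
Proof.
rewrite /gpower_adj; case E: (dist G x y) => [d|//] /andP[d0 _].
have [/walkP[[|a p] [sp pp _]] _] := (distP G x y d).1 E.
  by rewrite -sp in d0.
by case/andP: pp => /adj_vset.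
Qed.

Definition gpower G (k : nat) : sgraph T :=
  SGraph (gpower_sym G k) (gpower_irr G k) (@gpower_vset G k).

(* C_n, with the vertices 1, ..., n shifted to 0, ..., n - 1. *)
Definition cycle_adj (n : nat) : rel 'I_n := fun i j =>
  [|| i.+1 == j, j.+1 == i,
      (i.+1 == n) && (j == 0 :> nat) | (j.+1 == n) && (i == 0 :> nat)].

Definition is_cycle G : Prop :=
  exists n : nat, 3 <= n /\
  exists f : 'I_n -> T,
    [/\ injective f, vset G = [set f i | i : 'I_n]
      & forall i j, adj G (f i) (f j) = cycle_adj i j].

Definition is_disjoint_union (I : finType) (H : I -> sgraph T) G : Prop :=
  [/\ forall i j, i != j -> [disjoint vset (H i) & vset (H j)],
      vset G = \bigcup_i vset (H i)
    & forall x y, adj G x y = [exists i, adj (H i) x y]].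

Definition independent G A : bool :=
  (A \subset vset G) && [forall x in A, forall y in A, ~~ adj G x y].

Definition clique G A : bool :=
  (A \subset vset G) && [forall x in A, forall y in A, (x != y) ==> adj G x y].

Definition alpha G : nat := \max_(A | independent G A) #|A|.
Definition omega G : nat := \max_(A | clique G A) #|A|.

Definition indep_family G (r : nat) : {set {set T}} :=
  [set A | independent G A && (#|A| == r)].

Definition intersecting F : Prop :=
  forall A B, A \in F -> B \in F -> A :&: B != set0.

Definition star F (x : T) : {set {set T}} := [set A in F | x \in A].

Definition largest_intersecting F (S : {set {set T}}) : Prop :=
  [/\ S \subset F, intersecting S
    & forall S' : {set {set T}},
        S' \subset F -> intersecting S' -> #|S'| <= #|S|].

Definition EKR G (r : nat) : Prop :=
  exists2 x, x \in vset G &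
    largest_intersecting (indep_family G r) (star (indep_family G r) x).

End Graphs.

(* Main.v *)
(* Proof: let u, v be consecutive vertices of a component C_n^k with n >= 2k+2.
   Moving v to u sends the members of an intersecting family F to independent
   sets of the graph in which v is deleted from the cycle C_n, except for
   "tight" members, in which two elements at distance k+1 straddle the edge uv.
   The tight members, together with the members A with v in A whose shift is
   also in F, become, after deletion of the k+1 vertices from v on, distinct
   independent (r-1)-sets of the graph with these k+1 vertices removed from C_n,
   and they still form an intersecting family.  So the maximum sizes satisfy
   f(n, r) <= f(n-1, r) + f(n-k-1, r-1), while stars satisfy the same recurrence
   with >=.  For a complete component the same works with f(0, r-1) as the last
   term, provided the center of the star lies in another component.  Shrinking
   first the component of the center until it is complete, and then the others,
   whose cliques are large enough for this, leaves complete components of one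
   common order m >= 2; there the bound is Katona's cycle argument. *)
Require Import Defs.
From mathcomp Require Import all_boot fingroup perm zify.

Set Implicit Arguments.
Unset Strict Implicit.
Unset Printing Implicit Defensive.

(** * Contracting a window of vertices *)

Section Contraction.
Variable T : finType.
Implicit Types (A B X Y Z : {set T}) (F S : {set {set T}}).

(* S need only contain the star of x: this makes the bound usable for undecided
   predicates I and lets S be cut into pieces without injectivity arguments. *)
Definition star_bound (x : T) (I : {set T} -> Prop) (r : nat) : Prop :=
  forall F S,
    (forall A, A \in F -> I A /\ #|A| = r) -> intersecting F ->
    (forall A, I A -> #|A| = r -> x \in A -> A \in S) -> #|F| <= #|S|.

Lemma star_bound_ext x (I J : {set T} -> Prop) r :
  (forall A, I A <-> J A) -> star_bound x I r -> star_bound x J r.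
Proof.
move=> IJ bI F S FJ Fi SJ; apply: bI => // [A /FJ [/IJ]|A /IJ JA] //.
exact: SJ.
Qed.

(** Base case of the recursion on the size: the empty set does not meet itself, so [F] has no
    member. *)
Lemma star_bound0 x I : star_bound x I 0.
Proof.
move=> F S FI Fi _; suff -> : F = set0 by rewrite cards0.
apply/setP=> A; rewrite inE; apply/negP => FA.
have [_ /eqP] := FI A FA; rewrite cards_eq0 => /eqP A0.
by have := Fi A A FA FA; rewrite setIid A0 eqxx.
Qed.

(** Unlike the usual compression, this one does not look at the family; members whose shift already
    lies in [F] are set apart by [dup] below. *)
Definition shift (u v : T) A := if v \in A then u |: (A :\ v) else A.

(** * The contraction inequality for an abstract window *)

Section Window.
Variables (x : T) (k : nat) (p q : nat -> T) (I I' I'' : {set T} -> Prop).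
Let u := p k.
Let v := q 0.
Let Q := [set q i | i : 'I_k.+1].
(** In a cycle, [p 0], ..., [p k], [q 0], ..., [q k] will be consecutive, so that [p i] and [q i]
    are k+1 apart and straddle the edge from [u] to [v]. *)
Let tight A := [exists i : 'I_k.+1, (p i \in A) && (q i \in A)].

Hypothesis p_uniq : forall A i j, I A -> i <= k -> j <= k ->
  p i \in A -> p j \in A -> i = j.
Hypothesis q_uniq : forall A i j, I A -> i <= k -> j <= k ->
  q i \in A -> q j \in A -> i = j.
Hypothesis uvN : forall A, I A -> u \in A -> v \notin A.
Hypothesis pNQ : forall i, i <= k -> p i \notin Q.
Hypothesis shiftI : forall A, I A -> ~~ tight A -> I' (shift u v A).
Hypothesis tightI : forall A, I A -> tight A -> I'' (A :\: Q).
Hypothesis dupI : forall A,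
  I A -> v \in A -> I (u |: (A :\ v)) -> I'' (A :\: Q).
Hypothesis liftI' : forall A, I' A -> [/\ I A, v \notin A & ~~ tight A].
Hypothesis liftI'' : forall Z, I'' Z ->
  exists2 A, I A & (v \in A) || tight A /\ A :\: Q = Z.

Let vQ : v \in Q. Proof. by apply/imsetP; exists ord0. Qed.

Let tightP A : reflect (exists2 i, i <= k & p i \in A /\ q i \in A) (tight A).
Proof.
apply: (iffP existsP) => [[i /andP[pi qi]]|[i ik [pi qi]]].
  by exists i => //; rewrite -ltnS.
by exists (Ordinal (ik : i < k.+1)); rewrite pi qi.
Qed.

Let QP z : reflect (exists2 i, i <= k & z = q i) (z \in Q).
Proof.
apply: (iffP imsetP) => [[i _ ->]|[i ik ->]]; first by exists i; rewrite // -ltnS.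
by exists (Ordinal (ik : i < k.+1)).
Qed.

Let capQ A i : I A -> i <= k -> q i \in A -> A :&: Q = [set q i].
Proof.
move=> IA ik qi; apply/setP=> z; rewrite !inE; apply/andP/eqP => [[zA /QP[j jk zq]]|->].
  by rewrite zq; congr q; apply: (q_uniq IA) => //; rewrite -zq.
by split=> //; apply/QP; exists i.
Qed.

Let card_capQ A : I A -> (v \in A) || tight A -> #|A| = (#|A :\: Q|).+1.
Proof.
move=> IA h; rewrite -(cardsID Q A).
suff [i ik qi] : exists2 i, i <= k & q i \in A by rewrite (capQ IA ik qi) cards1.
by case/orP: h => [vA|/tightP[i ik [_ qi]]]; [exists 0|exists i].
Qed.

Let card_shift A : I A -> #|shift u v A| = #|A|.
Proof.
move=> IA; rewrite /shift; case: ifP => // vA.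
have uA : u \notin A by apply/negP => /(uvN IA); rewrite vA.
by rewrite cardsU1 !inE (negbTE uA) andbF (cardsD1 v A) vA.
Qed.

Let dup F A := (v \in A) && (u |: (A :\ v) \in F).

Let notQ A z : I A -> v \in A -> z \in A -> z != v -> z \notin Q.
Proof.
move=> IA vA zA zv; apply/negP => zQ.
have : z \in A :&: Q by rewrite inE zA.
by rewrite (capQ (i := 0) IA) // inE (negbTE zv).
Qed.

(* I' and I'' are the independent sets after deleting v and after deleting Q. *)
Lemma window_contraction r :
  star_bound x I' r.+1 -> star_bound x I'' r -> star_bound x I r.+1.
Proof.
move=> b' b'' F S FI Fi SI.
have II A : A \in F -> I A by case/FI.
(* [F1] gathers the members that will lose [Q], [F2] those that will be shifted. [S] is cut by a
   different criterion: [S2] receives the sets coming from [I'], [S1] the lifts from [I'']. *)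
pose P1 A := tight A || dup F A.
pose F1 := [set A in F | P1 A]; pose F2 := [set A in F | ~~ P1 A].
pose PS A := (v \in A) || tight A.
pose S1 := [set A in S | PS A]; pose S2 := [set A in S | ~~ PS A].
have cardF : #|F| = #|F2| + #|F1|.
  rewrite addnC -(cardsID [set A | P1 A] F); congr (_ + _); apply: eq_card => A;
  by rewrite !inE // andbC.
have cardS : #|S| = #|S2| + #|S1|.
  rewrite addnC -(cardsID [set A | PS A] S); congr (_ + _); apply: eq_card => A;
  by rewrite !inE // andbC.
have F1v A : A \in F1 -> (v \in A) || tight A.
  by rewrite inE => /andP[_ /orP[->|/andP[-> _]]]; rewrite ?orbT.
(* If [v] is in [A] but not in [B], equal shifts make [B] the shift of [A], so that [A] would be a
   [dup] member. *)
have card2 : #|[set shift u v A | A in F2]| = #|F2|.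
  apply: card_in_imset => A B; rewrite !inE => /andP[FA nA] /andP[FB nB].
  have uA C : C \in F -> v \in C -> u \notin C.
    by move=> FC vC; apply/negP => /(uvN (II _ FC)); rewrite vC.
  rewrite /shift; case: ifP => vA; case: ifP => vB // E.
  - have uD C : C \in F -> v \in C -> u \notin C :\ v.
      by move=> FC vC; rewrite in_setD1 negb_and (uA C) ?orbT.
    rewrite -(setD1K vA) -(setD1K vB); congr (_ |: _).
    by rewrite -(setU1K (uD A FA vA)) E setU1K ?uD.
  - by case/negP: nA; rewrite /P1 /dup vA E FB orbT.
  - by case/negP: nB; rewrite /P1 /dup vB -E FA orbT.
(* The remainder determines the single point of [A :&: Q]: it is [q a] if [A] is tight at [a], and
   [v] if [A] is [dup]. The two kinds never share a remainder: [p a] would lie in the shift of the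
   [dup] set [D] together with [u], forcing [p a = u], while [D] contains [v]. *)
have card1 : #|[set A :\: Q | A in F1]| = #|F1|.
  apply: card_in_imset => A B FA FB E.
  suff EQ : A :&: Q = B :&: Q by rewrite -(setID A Q) -(setID B Q) E EQ.
  have td (C D : {set T}) :
      C \in F -> D \in F -> C :\: Q = D :\: Q -> tight C -> dup F D -> False.
    move=> FC FD ED /tightP[a ak [pa qa]] /andP[vD uD].
    have paD : p a \in D.
      by have : p a \in D :\: Q; [rewrite -ED in_setD pNQ|rewrite in_setD => /andP[]].
    have ak' : a = k.
      apply: (p_uniq (II _ uD)) => //; last by rewrite !inE eqxx.
      by rewrite !inE paD andbT orbC; case: eqP => // pv;
        case/negP: (pNQ ak); rewrite pv.
    have uD' : u \in D by rewrite /u -ak'.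
    by have := uvN (II _ FD) uD'; rewrite vD.
  move: FA FB; rewrite !inE => /andP[FA PA] /andP[FB PB].
  case/orP: PA => [tA|dA]; case/orP: PB => [tB|dB].
  - case/tightP: (tA) => a ak [pa qa]; case/tightP: (tB) => b bk [pb qb].
    rewrite (capQ (II _ FA) ak qa) (capQ (II _ FB) bk qb).
    suff -> : a = b by [].
    apply: (p_uniq (II _ FB)) => //.
    by have : p a \in B :\: Q; [rewrite -E in_setD pNQ|rewrite in_setD => /andP[]].
  - by case: (td A B).
  - by case: (td B A).
  - have [/andP[vA _] /andP[vB _]] := (dA, dB).
    by rewrite (capQ (i := 0) (II _ FA)) // (capQ (i := 0) (II _ FB)).
have i2 : intersecting [set shift u v A | A in F2].
  move=> A' B' /imsetP[A + ->] /imsetP[B + ->]; rewrite !inE => /andP[FA _] /andP[FB _].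
  have /set0Pn[z] := Fi _ _ FA FB; rewrite inE => /andP[zA zB].
  apply/set0Pn; exists (if z == v then u else z); rewrite inE /shift.
  case: (eqVneq z v) zA zB => [->|zv] zA zB; first by rewrite zA zB !inE eqxx.
  by apply/andP; split; case: ifP; rewrite ?inE // ?zv ?zA ?zB orbT.
(* A common point is needed outside [Q]. A [dup] set meets [Q] only in [v], and replacing it by its
   shift, also in [F], avoids [v]. Two tight sets sharing [q i] share [p i] as well. *)
have i1 : intersecting [set A :\: Q | A in F1].
  have out (C D : {set T}) z : z \in C -> z \in D -> z \notin Q ->
      (C :\: Q) :&: (D :\: Q) != set0.
    by move=> zC zD zQ; apply/set0Pn; exists z; rewrite in_setI !in_setD zQ zC zD.
  have td A B : A \in F -> B \in F -> dup F A -> tight B ->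
      (A :\: Q) :&: (B :\: Q) != set0.
    move=> FA FB /andP[vA uA] tB; case: (boolP (v \in B)) => vB.
      have uB : u \notin B by apply/negP => /(uvN (II _ FB)); rewrite vB.
      have /set0Pn[z] := Fi _ _ uA FB.
      rewrite !inE => /andP[/orP[/eqP->|/andP[zv zA]] zB].
        by rewrite (negbTE uB) in zB.
      exact: out zA zB (notQ (II _ FA) vA zA zv).
    have /set0Pn[z] := Fi _ _ FA FB; rewrite inE => /andP[zA zB].
    have zv : z != v by apply: contraNneq vB => <-.
    exact: out zA zB (notQ (II _ FA) vA zA zv).
  move=> A' B' /imsetP[A + ->] /imsetP[B + ->].
  rewrite !inE => /andP[FA PA] /andP[FB PB].
  case/orP: PA => [tA|dA]; case/orP: PB => [tB|dB].
  - case/tightP: (tA) => a ak [pa qa]; case/tightP: (tB) => b bk [pb qb].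
    have /set0Pn[z] := Fi _ _ FA FB; rewrite inE => /andP[zA zB].
    case: (boolP (z \in Q)) => [/QP[i ik zq]|]; last exact: out.
    have ia : i = a by apply: (q_uniq (II _ FA)) => //; rewrite -zq.
    have ib : i = b by apply: (q_uniq (II _ FB)) => //; rewrite -zq.
    by apply: (out _ _ (p a)); rewrite ?pNQ // -ia ib.
  - by rewrite setIC; apply: td.
  - exact: td.
  - case/andP: dA => vA uA; case/andP: dB => vB uB.
    have /set0Pn[z] := Fi _ _ FA uB.
    rewrite !inE => /andP[zA /orP[/eqP zu|/andP[zv zB]]].
      by have := uvN (II _ FA); rewrite -zu zA vA => /(_ isT).
    exact: out zA zB (notQ (II _ FA) vA zA zv).
have s2 : #|[set shift u v A | A in F2]| <= #|S2|.
  apply: b' => // [A' /imsetP[A + ->]|A I'A cA xA].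
    rewrite inE => /andP[FA]; rewrite negb_or => /andP[tA _].
    split; first by apply: shiftI => //; apply: II.
    by rewrite card_shift; [case: (FI _ FA)|apply: II].
  have [IA vA tA] := liftI' I'A.
  by rewrite inE SI // negb_or vA tA.
(* One lift for each [Z] is enough, since the image of [S1] is at most as large as [S1]. *)
have s1 : #|[set A :\: Q | A in F1]| <= #|[set A :\: Q | A in S1]|.
  apply: b'' => // [A' /imsetP[A FA ->]|Z I''Z cZ xZ].
    have FA' : A \in F by move: FA; rewrite inE => /andP[].
    have [IA cA] := FI _ FA'.
    split; last by apply: succn_inj; rewrite -cA (card_capQ IA) // F1v.
    move: FA; rewrite inE => /andP[_ /orP[tA|/andP[vA uA]]]; first exact: tightI.
    by apply: dupI => //; apply: II.
  have [A IA [PA E]] := liftI'' I''Z.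
  apply/imsetP; exists A => //; rewrite inE [PS _]PA andbT.
  apply: SI => //; first by rewrite (card_capQ IA) // E cZ.
  by move: xZ; rewrite -E inE => /andP[].
rewrite cardF cardS -card2 -card1 leq_add //.
by apply: (leq_trans s1); apply: leq_imset_card.
Qed.

End Window.
End Contraction.

(** * Separated sets on cyclic sequences *)

Section Separated.
Variables (T : finType) (x0 : T).
Implicit Types (A B : {set T}) (c : seq T).

(* Restated at the carrier of T, so that lia identifies the terms size c. *)
Let nth_in c i : i < size c -> nth x0 c i \in c.
Proof. exact: mem_nth. Qed.

Let nth_eq c i j : i < size c -> j < size c -> uniq c ->
  (nth x0 c i == nth x0 c j) = (i == j).
Proof. exact: nth_uniq. Qed.

Let nth_ex c y : y \in c -> exists2 i, i < size c & nth x0 c i = y.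
Proof. by move/(nthP x0). Qed.

(** Independence in the k-th power of the cycle [c]: the two inequalities say that both arcs between
    the positions i and j are longer than k. *)
Definition sep c k A : Prop := forall i j, i < j < size c ->
  nth x0 c i \in A -> nth x0 c j \in A -> k < j - i /\ k + (j - i) < size c.

Lemma sep_eq_in c k A B : {in c, A =i B} -> sep c k A -> sep c k B.
Proof.
move=> AB sA i j /andP[ij jn] iB jB.
have mem l : l < size c -> nth x0 c l \in B -> nth x0 c l \in A.
  by move=> ln; rewrite AB // nth_in.
by apply: sA; rewrite ?ij // mem //; lia.
Qed.

(** The two arcs between two positions have total length at most 2k+1, so they cannot both exceed
    k. *)
Lemma sep_complete c k A : size c <= k.*2.+1 ->
  sep c k A <-> forall i j, i < size c -> j < size c ->
    nth x0 c i \in A -> nth x0 c j \in A -> i = j.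
Proof.
move=> ck; split=> [sA i j ic jc iA jA|uA i j ij iA jA].
  case: (ltngtP i j) => // ij; first by have := sA i j _ iA jA; lia.
  by have := sA j i _ jA iA; lia.
by have := uA i j _ _ iA jA; lia.
Qed.

(** * Deleting a block of consecutive positions *)

Definition cut a b c := take a c ++ drop b c.

Lemma size_cut a b c : a <= b <= size c -> size (cut a b c) = size c - (b - a).
Proof. by move=> abc; rewrite size_cat size_drop size_takel; lia. Qed.

(** Translates positions of [cut a b c] into positions of [c]; [skipP] presents it as a disjunction
    fit for linear arithmetic. *)
Definition skip a b i := if i < a then i else i - a + b.

Lemma skipP a b i :
  i < a /\ skip a b i = i \/ a <= i /\ skip a b i = i - a + b.
Proof. by rewrite /skip; case: (ltnP i a) => ia; [left|right]. Qed.

Lemma nth_cut a b c i : a <= b <= size c ->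
  nth x0 (cut a b c) i = nth x0 c (skip a b i).
Proof.
move=> abc; rewrite nth_cat size_takel /skip; last by lia.
by case: ifP => ia; [rewrite nth_take|rewrite nth_drop addnC].
Qed.

Lemma cut_subset a b c : {subset cut a b c <= c}.
Proof. by move=> y; rewrite mem_cat => /orP[/mem_take|/mem_drop]. Qed.

Lemma cut_uniq a b c : a <= b -> uniq c -> uniq (cut a b c).
Proof.
move=> ab; apply: subseq_uniq; rewrite -{2}(cat_take_drop a c).
rewrite cat_subseq // -(subnK ab) -drop_drop; exact: drop_subseq.
Qed.

Lemma cutN a b c i : a <= b <= size c -> uniq c -> a <= i < b ->
  nth x0 c i \notin cut a b c.
Proof.
move=> abc Uc iab; apply/negP => /(nthP x0)[j].
rewrite size_cut // nth_cut // => jn /eqP.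
by have := skipP a b j; set j' := skip a b j => h; rewrite nth_eq //; lia.
Qed.

Lemma mem_cut a b c y : a <= b <= size c -> uniq c -> y \in c ->
  (forall i, a <= i < b -> y != nth x0 c i) -> y \in cut a b c.
Proof.
move=> abc Uc /nth_ex[i ic <-] yN; apply/(nthP x0).
have iab : ~~ (a <= i < b) by apply/negP => /yN; rewrite eqxx.
exists (if i < a then i else i - (b - a)).
  by rewrite size_cut //; case: ifP; lia.
rewrite nth_cut //; case: ifP => ia; congr nth; [have := skipP a b i|
  have := skipP a b (i - (b - a))]; lia.
Qed.

(* The independent sets of a graph one of whose components is given by c and k;
   W and R stand for the other components. *)
Section Local.
Variables (x : T) (c : seq T) (k : nat) (W : T -> Prop) (R : {set T} -> Prop).
Hypotheses (Uc : uniq c) (Wc : forall y, W y -> y \notin c).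
Hypothesis R_ext : forall A B,
  (forall y, y \notin c -> (y \in A) = (y \in B)) -> R A -> R B.

Definition local c' A : Prop :=
  [/\ forall y, y \in A -> y \in c' \/ W y, sep c' k A & R A].

(** The window occupies positions 0 to 2k+1: [u] is at k, [v] at k+1, and [Q] fills k+1 to 2k+1.
    Position 0 survives both cuts. *)
Lemma local_cycle r : 0 < k -> k.*2.+1 < size c ->
  star_bound x (local (cut k.+1 k.+2 c)) r.+1 ->
  star_bound x (local (cut k.+1 k.*2.+2 c)) r ->
  star_bound x (local c) r.+1.
Proof.
move=> k0 kn b1 b2.
pose p i := nth x0 c i; pose q i := nth x0 c (k.+1 + i).
pose Q := [set q i | i : 'I_k.+1].
have h1 : k.+1 <= k.+2 <= size c by lia.
have h2 : k.+1 <= k.*2.+2 <= size c by lia.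
have pc i : i <= k -> p i \in c by move=> ik; rewrite nth_in //; lia.
have qc i : i <= k -> q i \in c by move=> ik; rewrite nth_in //; lia.
have inQ l : l < size c -> (nth x0 c l \in Q) = (k < l <= k.*2.+1).
  move=> lc; apply/imsetP/idP => [[i _ /eqP]|kl].
    by rewrite nth_eq //; have := ltn_ord i; lia.
  have lk : l - k.+1 < k.+1 by lia.
  by exists (Ordinal lk) => //; rewrite /q /=; congr nth; lia.
have Qc y : y \in Q -> y \in c.
  by case/imsetP=> i _ ->; apply: qc; rewrite -ltnS.
have R_Q A : R A -> R (A :\: Q).
  move=> rA; apply: R_ext rA => y yc; rewrite in_setD.
  by case: (boolP (y \in Q)) => // /Qc; rewrite (negbTE yc).
have cover_Q A : (forall y, y \in A -> y \in c \/ W y) -> forall y, y \in A :\: Q ->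
    y \in cut k.+1 k.*2.+2 c \/ W y.
  move=> cA y /setDP[/cA[yc|]]; [left|by right].
  apply: mem_cut => // i ik; apply: contraNneq b => ->.
  by rewrite inQ; lia.
have tightP A : reflect
   (exists2 i, i <= k & nth x0 c i \in A /\ nth x0 c (k.+1 + i) \in A)
   [exists i : 'I_k.+1, (p i \in A) && (q i \in A)].
  apply: (iffP existsP) => [[i /andP[pi qi]]|[i ik [pi qi]]].
    by exists i => //; rewrite -ltnS.
  by exists (Ordinal (ik : i < k.+1)); rewrite /p /q pi qi.
apply: (@window_contraction T x k p q _ _ _ _ _ _ _ _ _ _ _ _ r b1 b2).
- move=> A i j [_ sA _] ik jk iA jA.
  case: (ltngtP i j) => // ij; first by have := sA i j _ iA jA; lia.
  by have := sA j i _ jA iA; lia.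
- move=> A i j [_ sA _] ik jk iA jA.
  case: (ltngtP i j) => // ij; first by have := sA _ _ _ iA jA; lia.
  by have := sA _ _ _ jA iA; lia.
- move=> A [_ sA _] uA; apply/negP => vA.
  by have := sA k (k.+1 + 0) _ uA vA; lia.
- by move=> i ik; rewrite inQ //; lia.
(* Shifting and then deleting [v] merges it with [u], which shortens by one the arcs over the edge
   between them. Only arcs of length k+1 become too short; they start at positions 0 to k, so they
   are the tight pairs. *)
- move=> A [cA sA rA] nt.
  have {}nt i j : i <= k -> j = k.+1 + i ->
      nth x0 c i \in A -> nth x0 c j \in A -> False.
    by move=> ik -> pi qi; case/tightP: nt; exists i.
  have sh l : l < size c -> nth x0 c l \in shift (p k) (q 0) A ->
      l != k.+1 /\ (nth x0 c l \in A \/ l = k /\ nth x0 c k.+1 \in A).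
    move=> lc; rewrite /shift /q addn0; case: ifP => [vA|/negbT vA lA].
      rewrite !inE !nth_eq //; last by lia.
        by case/orP => [/eqP ->|/andP[-> ->]]; split; auto; lia.
      by lia.
    by split; [apply: contraNneq vA => <-|left].
  split.
  + have Cv y : y \in c -> y != q 0 -> y \in cut k.+1 k.+2 c.
      move=> yc yv; apply: mem_cut => // i ik.
      by have -> : i = k.+1 + 0 by lia.
    move=> y; rewrite /shift; case: ifP => [vA|/negbT vA yA].
      rewrite !inE => /orP[/eqP ->|/andP[yv /cA[yc|]]]; [left|left|by right].
        by apply: Cv; rewrite ?pc // nth_eq //; lia.
      exact: Cv.
    have yv : y != q 0 by apply: contraNneq vA => <-.
    by case: (cA _ yA); [left; apply: Cv|right].
  + move=> i j; rewrite size_cut // !nth_cut // => /andP[ij jn].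
    have := skipP k.+1 k.+2 i; have := skipP k.+1 k.+2 j.
    set i' := skip _ _ i; set j' := skip _ _ j => hj hi.
    move=> /sh[|ik i2]; first by lia.
    move=> /sh[|jk j2]; first by lia.
    case: i2 => [iA|[ik' vA]]; case: j2 => [jA|[jk' vA']].
    * have := sA i' j' _ iA jA; have := nt i' j' _ _ iA jA; lia.
    * have := sA i' k.+1 _ iA vA'; have := nt i' k.+1 _ _ iA vA'; lia.
    * by have := sA k.+1 j' _ vA jA; lia.
    * by lia.
  + apply: R_ext rA => y yc; rewrite /shift; case: ifP => // vA.
    rewrite !inE; case: eqP => [yu|_]; first by rewrite yu pc in yc.
    by case: eqP => // yv; rewrite yv qc in yc.
(* At positions up to k, [A] contains only [p t]. An element beyond [Q] is more than k after [q t],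
   hence more than 2k+1 after [p t], and k+1 of these steps are removed. *)
- move=> A [cA sA rA] /tightP[t tk [pt qt]]; split; [exact: cover_Q| |exact: R_Q].
  move=> i j; rewrite size_cut // !nth_cut // => /andP[ij jn].
  have := skipP k.+1 k.*2.+2 i; have := skipP k.+1 k.*2.+2 j.
  set i' := skip _ _ i; set j' := skip _ _ j => hj hi.
  move=> /setDP[iA _] /setDP[jA _].
  case: (ltngtP i' t) => ti.
  + by have := sA _ _ _ iA pt; have := sA i' j' _ iA jA; lia.
  + by have := sA _ _ _ pt iA; have := sA i' j' _ iA jA; lia.
  + by subst t; have := sA _ j' _ qt jA; have := sA i' j' _ iA jA; lia.
- move=> A [cA sA rA] vA [_ sA' _]; split; [exact: cover_Q| |exact: R_Q].
  move=> i j; rewrite size_cut // !nth_cut // => /andP[ij jn].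
  have := skipP k.+1 k.*2.+2 i; have := skipP k.+1 k.*2.+2 j.
  set i' := skip _ _ i; set j' := skip _ _ j => hj hi.
  move=> /setDP[iA _] /setDP[jA _].
  (* No element of [A] lies at a position up to k: [u] is excluded by [v], and the earlier ones are
     too close to [u] in the shift of [A]. So no remaining pair has [Q] between its positions. *)
  case: (leqP i' k) => ik; last by have := sA i' j' _ iA jA; lia.
  have ik' : i' <> k.
    by move=> e; have := sA k (k.+1 + 0) _ _ vA; rewrite -e => /(_ _ iA); lia.
  have := sA' i' k; rewrite !inE eqxx !nth_eq ?iA; lia.
- move=> Y [cY sY rY].
  have vY : nth x0 c k.+1 \notin Y.
    apply/negP => /cY[|/Wc]; first by apply/negP/cutN => //; lia.
    by rewrite nth_in //; lia.
  have sY' i j : i < j < size c -> nth x0 c i \in Y -> nth x0 c j \in Y ->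
      exists i' j', [/\ skip k.+1 k.+2 i' = i, skip k.+1 k.+2 j' = j,
      i' < j' < (size c).-1,
      k < j' - i' & k + (j' - i') < (size c).-1].
    move=> ij iY jY.
    have ik : i != k.+1 by apply: contraNneq vY => <-.
    have jk : j != k.+1 by apply: contraNneq vY => <-.
    (* [f] inverts [skip] away from the deleted position. *)
    pose f l := if l <= k then l else l.-1.
    have ff l : l <= k /\ f l = l \/ k < l /\ f l = l.-1.
      by rewrite /f; case: (leqP l k); auto.
    have [] := (ff i, ff j) => fi fj.
    have ei : skip k.+1 k.+2 (f i) = i by have := skipP k.+1 k.+2 (f i); lia.
    have ej : skip k.+1 k.+2 (f j) = j by have := skipP k.+1 k.+2 (f j); lia.
    exists (f i), (f j); rewrite ei ej; have := sY (f i) (f j).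
    rewrite size_cut // !nth_cut // ei ej => /(_ _ iY jY) h.
    by split=> //; lia.
  split; last 1 first.
  (* With [i] nonzero, a tight pair would be only k apart once [v] is deleted; with [i] zero it
     would contain [v]. *)
  + apply/tightP => -[i ik [iY jY]].
    have [|i' [j' [ei ej _]]] := sY' _ _ _ iY jY; first by lia.
    have := skipP k.+1 k.+2 i'; have := skipP k.+1 k.+2 j'; rewrite ei ej.
    have : i <> 0 by move=> i0; move: jY; rewrite i0 addn0 (negbTE vY).
    lia.
  + split=> // [y /cY[/cut_subset|]|i j ij iY jY]; [by left|by right|].
    have [i' [j' [ei ej]]] := sY' _ _ ij iY jY.
    have := skipP k.+1 k.+2 i'; have := skipP k.+1 k.+2 j'; rewrite ei ej.
    lia.
  + by rewrite /q addn0.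
- move=> Z [cZ sZ rZ].
  have Zpos l : l < size c -> nth x0 c l \in Z -> l <= k \/ k.*2.+1 < l.
    move=> lc lZ; case: (cZ _ lZ) => [lcut|/Wc]; last by rewrite nth_in.
    case: (leqP l k) => [|kl]; [by left|case: (ltnP k.*2.+1 l); [by right|move=> lk]].
    have /negP[] // : nth x0 c l \notin cut k.+1 k.*2.+2 c.
    by apply: cutN => //; rewrite kl.
  pose f l := if l <= k then l else l - k.+1.
  have ff l : l <= k /\ f l = l \/ k < l /\ f l = l - k.+1.
    by rewrite /f; case: (leqP l k); auto.
  have sZ' i j : i < j < size c -> nth x0 c i \in Z -> nth x0 c j \in Z ->
      k < f j - f i /\ k + (f j - f i) < size c - k.+1.
    move=> ij iZ jZ; have := sZ (f i) (f j).
    have [] := (ff i, ff j) => fi fj.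
    have [] : (i <= k \/ k.*2.+1 < i) /\ (j <= k \/ k.*2.+1 < j).
      by split; apply: Zpos => //; lia.
    move=> Zi Zj.
    have ei : skip k.+1 k.*2.+2 (f i) = i by have := skipP k.+1 k.*2.+2 (f i); lia.
    have ej : skip k.+1 k.*2.+2 (f j) = j by have := skipP k.+1 k.*2.+2 (f j); lia.
    rewrite size_cut // !nth_cut // ei ej => /(_ _ iZ jZ); lia.
  (* The lift adds [q t] to [Z], where t is the position of the only element of [Z] up to k. Then
     the lift is tight; if there is no such element, the default t = 0 adds [v] itself. *)
  have [t [tk tZ tu]] : exists t, [/\ t <= k, t = 0 \/ nth x0 c t \in Z &
      forall l, l <= k -> nth x0 c l \in Z -> l = t].
    case: (boolP [exists i : 'I_k.+1, p i \in Z]) => [/existsP[t tZ]|nZ].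
      exists t; split; [by rewrite -ltnS|by right|move=> l lk lZ].
      have tk := ltn_ord t; have := ff l; have := ff t.
      case: (ltngtP l t) => // lt; first by have := sZ' l t _ lZ tZ; lia.
      by have := sZ' t l _ tZ lZ; lia.
    exists 0; split=> //; [by left|move=> l lk lZ].
    by case/existsP: nZ; exists (Ordinal (lk : l < k.+1)).
  have tc : k.+1 + t < size c by lia.
  exists (nth x0 c (k.+1 + t) |: Z); last split.
  + split.
    * move=> y; rewrite !inE => /orP[/eqP ->|/cZ[/cut_subset|]]; [|by left|by right].
      by left; rewrite nth_in.
    * move=> i j ij; have [ic jc] : i < size c /\ j < size c by lia.
      rewrite !inE !nth_eq // => /orP[/eqP it|iZ] /orP[/eqP jt|jZ]; try lia.
      - have := Zpos j jc jZ; have := ff j; have := ff t.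
        by case: tZ => [t0|tZ]; [|have := sZ' t j _ tZ jZ]; lia.
      - have := Zpos i ic iZ; have := ff i; have := ff t.
        case: tZ => [t0|tZ]; first by have := tu i; lia.
        case: (leqP i k) => [/tu/(_ iZ)|]; first by lia.
        by have := sZ' t i _ tZ iZ; lia.
      - have := sZ' i j ij iZ jZ; have := Zpos i ic iZ; have := Zpos j jc jZ.
        by have := ff i; have := ff j; lia.
    * apply: R_ext rZ => y yc; rewrite !inE; case: eqP => // yq.
      by rewrite yq nth_in in yc.
  + case: tZ => [t0|tZ]; apply/orP.
      by left; rewrite /q t0 !inE eqxx.
    by right; apply/tightP; exists t => //; rewrite !inE eqxx tZ orbT.
  + apply/setP=> y; rewrite in_setD !inE; case: (boolP (y \in Q)) => yQ /=.
      apply/esym/negP => yZ; have /nth_ex[l lc E] := Qc _ yQ.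
      by move: yQ yZ; rewrite -E inQ // => lQ /(Zpos l lc); lia.
    by case: eqP => // yq; rewrite yq inQ in yQ; lia.
Qed.

(** A window with constant [p] and [q], so that [Q] is just [v]. No independent set is tight, since
    [u] and [v] are adjacent, and a set containing [v] has no other element in [c]: removing [v]
    leaves the component empty. *)
Lemma local_complete r : 1 < size c <= k.*2.+1 ->
  star_bound x (local (cut 1 2 c)) r.+1 -> star_bound x (local [::]) r ->
  star_bound x (local c) r.+1.
Proof.
move=> /andP[c1 ck] b1 b2.
have h : 1 <= 2 <= size c by lia.
have ck' : size (cut 1 2 c) <= k.*2.+1 by rewrite size_cut //; lia.
pose u := nth x0 c 0; pose v := nth x0 c 1.
have uc : u \in c by rewrite nth_in //; lia.
have vc : v \in c by rewrite nth_in.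
have uv : u == v = false by rewrite nth_eq //; lia.
have QE : [set v | i : 'I_1] = [set v].
  by apply/setP=> y; rewrite inE; apply/imsetP/eqP => [[]|->] //; exists ord0.
have sh2 A i j : i < size c -> j < size c -> i <> j -> sep c k A ->
    nth x0 c i \in A -> nth x0 c j \in A -> False.
  by move=> ic jc ij /sep_complete sA iA jA; apply: ij; apply: sA.
have uvF A : sep c k A -> u \in A -> v \in A -> False.
  by move=> sA uA vA; apply: (sh2 A 0 1) => //; lia.
have nt A : sep c k A -> [exists i : 'I_1, (u \in A) && (v \in A)] = false.
  by move=> sA; apply/existsP => -[_ /andP[uA vA]]; apply: (uvF A).
apply: (@window_contraction T x 0 (fun=> u) (fun=> v) _ _ _ _ _ _ _ _ _ _ _ _ r b1 b2);
  rewrite ?QE.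
- by move=> A i j _; rewrite !leqn0 => /eqP -> /eqP ->.
- by move=> A i j _; rewrite !leqn0 => /eqP -> /eqP ->.
- by move=> A [_ sA _] uA; apply/negP => /(uvF A sA uA).
- by move=> i _; rewrite inE uv.
- move=> A [cA sA rA] _; split.
  + have Cv y : y \in c -> y != v -> y \in cut 1 2 c.
      by move=> yc yv; apply: mem_cut => // i ik; have -> : i = 1 by lia.
    move=> y; rewrite /shift; case: ifP => [vA|/negbT vA yA].
      rewrite !inE => /orP[/eqP ->|/andP[yv /cA[yc|]]]; [left|left|by right].
        by apply: Cv; rewrite ?uv.
      exact: Cv.
    have yv : y != v by apply: contraNneq vA => <-.
    by case: (cA _ yA); [left; apply: Cv|right].
  + apply/sep_complete => // i j; rewrite size_cut // !nth_cut // => ic jc.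
    have := skipP 1 2 i; have := skipP 1 2 j.
    set i' := skip _ _ i; set j' := skip _ _ j => hj hi.
    have sh l : l < size c -> nth x0 c l \in shift u v A ->
        nth x0 c l \in A \/ l = 0 /\ v \in A.
      move=> lc; rewrite /shift; case: ifP => vA; last by left.
      rewrite !inE /u nth_eq //; last by lia.
      by case/orP=> [/eqP|/andP[_]]; auto.
    move=> /sh[|iA|[i0 vA]]; first by lia.
      move=> /sh[|jA|[j0 vA]]; first by lia.
        by have := sh2 A i' j' _ _ _ sA iA jA; lia.
      by have := sh2 A i' 1 _ _ _ sA iA vA; lia.
    move=> /sh[|jA|[j0 _]]; [by lia| |by lia].
    by have := sh2 A j' 1 _ _ _ sA jA vA; lia.
  + apply: R_ext rA => y yc; rewrite /shift; case: ifP => // vA.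
    rewrite !inE; case: eqP => [yu|_]; first by rewrite yu uc in yc.
    by case: eqP => // yv; rewrite yv vc in yc.
- by move=> A [_ sA _]; rewrite nt.
- move=> A [cA sA rA] vA _; split.
  + move=> y; rewrite !inE => /andP[yv yA]; case: (cA _ yA); [|by right].
    case/nth_ex=> l lc ly; exfalso; apply: (sh2 A l 1) => //; rewrite ?ly //.
    by move=> l1; case/eqP: yv; rewrite -ly l1.
  + by move=> i j; rewrite ltn0 andbF.
  + apply: R_ext rA => y yc; rewrite !inE; case: eqP => // yv.
    by rewrite yv vc in yc.
- move=> Y [cY sY rY].
  have vY : v \notin Y.
    apply/negP => /cY[|/Wc]; first by apply/negP/cutN.
    by rewrite vc.
  have sY' : sep c k Y.
    apply/sep_complete => // i j ic jc iY jY.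
    have i1 : i != 1 by apply: contraNneq vY => E; rewrite /v -E.
    have j1 : j != 1 by apply: contraNneq vY => E; rewrite /v -E.
    have := skipP 1 2 i.-1; have := skipP 1 2 j.-1 => hj hi.
    have ei : skip 1 2 i.-1 = i by lia.
    have ej : skip 1 2 j.-1 = j by lia.
    move/sep_complete: sY => /(_ ck' i.-1 j.-1).
    by rewrite size_cut // !nth_cut // ei ej => /(_ _ _ iY jY); lia.
  split=> //; last by rewrite nt.
  by split=> // y /cY[/cut_subset|]; [left|right].
- move=> Z [cZ sZ rZ]; have Zc y : y \in c -> y \notin Z.
    by move=> yc; apply/negP => /cZ[|/Wc] //; rewrite yc.
  exists (v |: Z); last first.
    rewrite !inE eqxx; split=> //; apply/setP=> y; rewrite !inE.
    by case: eqP => // ->; rewrite (negbTE (Zc v vc)).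
  split.
  + by move=> y; rewrite !inE => /orP[/eqP ->|/cZ[]]; [left| |right].
  + apply/sep_complete => // i j ic jc; rewrite !inE !nth_eq //.
    by rewrite !(negbTE (Zc _ _)) ?nth_in // !orbF => /eqP -> /eqP ->.
  + by apply: R_ext rZ => y yc; rewrite !inE; case: eqP => // yv; rewrite yv vc in yc.
Qed.

End Local.

(** * Several components at once *)

Section Configurations.
Variables (I : finType) (k : I -> nat).
Implicit Type d : I -> seq T.
Definition indep d A : Prop :=
  (forall y, y \in A -> exists i, y \in d i) /\ forall i, sep (d i) (k i) A.

Definition disjoint_seqs d : Prop :=
  (forall i, uniq (d i)) /\ forall i j y, y \in d i -> y \in d j -> i = j.

Definition upd d i0 s : I -> seq T := fun i => if i == i0 then s else d i.

Lemma updE d i0 s : upd d i0 s i0 = s. Proof. by rewrite /upd eqxx. Qed.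

Lemma updN d i0 s i : i != i0 -> upd d i0 s i = d i.
Proof. by rewrite /upd => /negbTE ->. Qed.

Lemma upd_disjoint d i0 s : uniq s -> {subset s <= d i0} ->
  disjoint_seqs d -> disjoint_seqs (upd d i0 s).
Proof.
move=> Us sc [Uc Dc]; split=> [i|i j y]; first by rewrite /upd; case: ifP.
have sub l : y \in upd d i0 s l -> y \in d l.
  by rewrite /upd; case: eqP => [->|_] //; apply: sc.
by move=> /sub + /sub; apply: Dc.
Qed.

Lemma sum_upd d i0 s :
  \sum_i size (upd d i0 s i) + size (d i0) = \sum_i size (d i) + size s.
Proof.
rewrite (bigD1 i0) //= [in RHS](bigD1 i0) //= updE.
rewrite (eq_bigr (fun i => size (d i))) => [|i ii0]; first by lia.
by rewrite updN.
Qed.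

(** [W] and [R] describe the components other than [i0], as parameters for [local]. *)
Let W d i0 y := exists2 i, i != i0 & y \in d i.
Let R d i0 A := forall i, i != i0 -> sep (d i) (k i) A.

Lemma indep_local d i0 s A :
  indep (upd d i0 s) A <-> local (k i0) (W d i0) (R d i0) s A.
Proof.
split=> [[cA sA]|[cA sA rA]]; split.
- move=> y /cA[i]; rewrite /upd; case: eqP => [_|/eqP ii0]; first by left.
  by right; exists i.
- by have := sA i0; rewrite updE.
- by move=> i ii0; have := sA i; rewrite updN.
- move=> y /cA[ys|[i ii0 yi]]; first by exists i0; rewrite updE.
  by exists i; rewrite updN.
- by move=> i; rewrite /upd; case: eqP => [->|/eqP] //; apply: rA.
Qed.

Lemma indep_upd_id d i0 A : indep (upd d i0 (d i0)) A <-> indep d A.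
Proof.
have E i : upd d i0 (d i0) i = d i by rewrite /upd; case: eqP => [->|].
by split=> -[cA sA]; split=> [y /cA[i]|i];
  [exists i; rewrite -E|rewrite -E|exists i; rewrite E|rewrite E].
Qed.

Section Move.
Variables (x : T) (c : I -> seq T) (i0 : I).
Hypothesis Dc : disjoint_seqs c.

Let Wc y : W c i0 y -> y \notin c i0.
Proof. by case=> i ii0 yi; apply: contraNN ii0 => /(Dc.2 _ _ _ yi) ->. Qed.

Let R_ext A B :
  (forall y, y \notin c i0 -> (y \in A) = (y \in B)) -> R c i0 A -> R c i0 B.
Proof.
move=> AB rA i ii0; apply: sep_eq_in (rA i ii0) => y yi.
by apply: AB; apply: Wc; exists i.
Qed.

Lemma indep_cycle r : 0 < k i0 -> (k i0).*2.+1 < size (c i0) ->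
  star_bound x (indep (upd c i0 (cut (k i0).+1 (k i0).+2 (c i0)))) r.+1 ->
  star_bound x (indep (upd c i0 (cut (k i0).+1 (k i0).*2.+2 (c i0)))) r ->
  star_bound x (indep c) r.+1.
Proof.
move=> k0 kc b1 b2; apply: star_bound_ext (indep_upd_id c i0) _.
apply: star_bound_ext (fun A => iff_sym (indep_local c i0 _ A)) _.
apply: local_cycle => //; first exact: Dc.1.
  exact: star_bound_ext (indep_local c i0 _) b1.
exact: star_bound_ext (indep_local c i0 _) b2.
Qed.

Lemma indep_complete r : 1 < size (c i0) <= (k i0).*2.+1 ->
  star_bound x (indep (upd c i0 (cut 1 2 (c i0)))) r.+1 ->
  star_bound x (indep (upd c i0 [::])) r ->
  star_bound x (indep c) r.+1.
Proof.
move=> kc b1 b2; apply: star_bound_ext (indep_upd_id c i0) _.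
apply: star_bound_ext (fun A => iff_sym (indep_local c i0 _ A)) _.
apply: local_complete => //; first exact: Dc.1.
  exact: star_bound_ext (indep_local c i0 _) b1.
exact: star_bound_ext (indep_local c i0 _) b2.
Qed.

End Move.
End Configurations.
End Separated.

(** * Katona's cycle method *)

(** Measured from the least element a of [S], every offset is below r or above N-r. Subtracting N-r
    from the large ones maps [S] into r values, injectively: two elements that differ by N-r are
    cyclically at distance r or more, as 2r is at most N. This serves both for arcs and for cliques
    of cycle powers. *)
Lemma card_circular_clique N r (S : {set 'I_N}) : 0 < r -> r.*2 <= N ->
  (forall a b : 'I_N, a \in S -> b \in S -> a < b ->
    (b - a < r) || (N - (b - a) < r)) ->
  #|S| <= r.
Proof.
move=> r0 rN close; case: (set_0Vmem S) => [->|[s sS]]; first by rewrite cards0.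
case: (arg_minnP (fun a : 'I_N => a : nat) sS) => a aS amin.
pose g (b : 'I_N) := if b - a < r then b - a else b - a - (N - r).
have near b : b \in S -> a <= b /\ (b - a < r) || (N - r < b - a).
  move=> bS; have ab := amin b bS; have := close a b aS bS; have := ltn_ord b.
  by case: (ltngtP a b) ab => //; lia.
have gr b : b \in S -> g b < r.
  by move=> /near; rewrite /g; have := ltn_ord b; case: ifP => //; lia.
have inj : {in S &, injective g}.
  move=> b b' bS b'S; have := near b bS; have := near b' b'S.
  have := close b b' bS b'S; have := close b' b b'S bS.
  have := ltn_ord b; have := ltn_ord b'.
  by rewrite /g; case: ifP; case: ifP; move=> *; apply: val_inj; rewrite /=; lia.
pose h (b : 'I_N) : 'I_r := insubd (Ordinal r0) (g b).
have hE b : b \in S -> h b = g b :> nat by move=> bS; rewrite val_insubd gr.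
rewrite -[r in _ <= r]card_ord -(card_in_imset (f := h) (D := mem S)) ?max_card //.
by move=> b b' bS b'S /(congr1 val); rewrite /= !hE //; apply: inj.
Qed.

(** Listing each set before its complement gives two enumerations of [X], which the permutation
    matches place by place. *)
Lemma exists_perm_imset (X : finType) (S S' : {set X}) :
  #|S| = #|S'| -> exists s : {perm X}, s @: S = S'.
Proof.
move=> SS'.
pose l (U : {set X}) := enum U ++ enum (~: U).
have lu U : uniq (l U).
  rewrite cat_uniq !enum_uniq andbT /=; apply/hasPn => y.
  by rewrite !mem_enum inE.
have lm U y : y \in l U by rewrite mem_cat !mem_enum inE orbN.
have ls U : size (l U) = #|X| by rewrite size_cat -!cardE cardsC.
pose f y := nth y (l S') (index y (l S)).
have f_inj : injective f.
  move=> y z; rewrite /f (set_nth_default z) ?ls -?(ls S) ?index_mem // => /eqP.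
  rewrite nth_uniq ?ls -?(ls S) ?index_mem // => /eqP.
  by apply: index_inj.
exists (perm f_inj); apply/eqP; rewrite eqEcard card_imset; last exact: perm_inj.
rewrite SS' leqnn andbT; apply/subsetP => _ /imsetP[y yS ->].
rewrite permE /f /l index_cat mem_enum yS nth_cat.
have -> : index y (enum S) < size (enum S').
  by rewrite -cardE -SS' cardE index_mem mem_enum.
by rewrite -mem_enum mem_nth // -cardE -SS' cardE index_mem mem_enum.
Qed.

(** * Intersecting families of partial transversals of [q] parts of size [m] *)

Section Multipartite.
Variables (q m : nat).
Let V : finType := ('I_q * 'I_m)%type.
Implicit Types (A B : {set V}).

Definition partial_transversal A : Prop := {in A &, injective fst}.

Let fibred (g : {perm V}) := [forall y, forall z, ((g y).1 == (g z).1) == (y.1 == z.1)].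

Let fibredP (g : {perm V}) :
  reflect (forall y z, ((g y).1 == (g z).1) = (y.1 == z.1)) (fibred g).
Proof.
apply: (iffP forallP) => [h y z|h y]; first by have /forallP/(_ z)/eqP := h y.
by apply/forallP => z; apply/eqP.
Qed.

Let fibredM g h : fibred g -> fibred h -> fibred (g * h)%g.
Proof.
by move=> /fibredP fg /fibredP fh; apply/fibredP => y z; rewrite !permM fh fg.
Qed.

Let fibredV g : fibred g -> fibred g^-1%g.
Proof. by move=> /fibredP fg; apply/fibredP => y z; rewrite -fg !permKV. Qed.

Let imset1 A : (1%g : {perm V}) @: A = A.
Proof. by rewrite (eq_imset (g := id)) ?imset_id // => y; rewrite perm1. Qed.

Let imsetM (g h : {perm V}) A : (g * h)%g @: A = h @: (g @: A).
Proof. by rewrite -imset_comp; apply: eq_imset => y; rewrite /= permM. Qed.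

(** A permutation of the parts carries those met by [A] to those met by [B]; then a transposition
    inside each part corrects the second coordinate. *)
Let transitive A B : partial_transversal A -> partial_transversal B -> #|A| = #|B| ->
  exists2 g : {perm V}, fibred g & g @: A = B.
Proof.
move=> tA tB AB.
have [s sAB] : exists s : {perm 'I_q}, s @: (fst @: A) = fst @: B.
  by apply: exists_perm_imset; rewrite !card_in_imset.
have [/cards0_eq A0|] := posnP #|A|.
  have B0 : B = set0 by apply/cards0_eq; rewrite -AB A0 cards0.
  exists 1%g; first by apply/fibredP => y z; rewrite !perm1.
  by rewrite A0 B0 imset0.
case/card_gt0P => a0 _.
(* The point [a0] only supplies a default label for parts that [U] misses, which is why an empty [A]
   was treated apart. *)
pose lab (U : {set V}) i := if [pick l | (i, l) \in U] is Some l then l else a0.2.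
have labE U y : partial_transversal U -> y \in U -> lab U y.1 = y.2.
  move=> tU yU; rewrite /lab; case: pickP => [l lU|/(_ y.2)]; last first.
    by rewrite -surjective_pairing yU.
  by have /(congr1 snd) := tU _ _ lU yU erefl.
pose f (y : V) : V := (s y.1, tperm (lab A y.1) (lab B (s y.1)) y.2).
have f_inj : injective f.
  by move=> [i l] [i' l'] [/perm_inj <- /perm_inj <-].
exists (perm f_inj).
  by apply/fibredP => y z; rewrite !permE /= (inj_eq perm_inj).
apply/eqP; rewrite eqEcard card_imset ?AB ?leqnn ?andbT; last exact: perm_inj.
apply/subsetP => _ /imsetP[y yA ->]; rewrite permE /f.
have /imsetP[z zB E] : s y.1 \in fst @: B by rewrite -sAB !imset_f.
by rewrite (labE A) // E (labE B) // tpermL -surjective_pairing.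
Qed.

Let N := q * m.
(** The arrangement runs through all parts at level 0, then through all parts at level 1, and so on;
    each part is a residue class modulo [q]. *)
Let pos (y : V) : nat := y.1 + y.2 * q.

Let pos_lt y : pos y < N.
Proof.
case: y => i l; rewrite /pos /N /=; have := ltn_ord i.
have : l.+1 * q <= m * q by rewrite leq_mul2r ltn_ord orbT.
by rewrite mulSn mulnC; lia.
Qed.

Let pos_inj : injective pos.
Proof.
move=> [i l] [i' l']; rewrite /pos /= => E.
have iq := ltn_ord i; have iq' := ltn_ord i'.
suff ll : l = l'.
  by move: E; rewrite ll => /addIn ii; congr pair; apply: val_inj.
apply: val_inj; have [ll|ll|//] := ltngtP (l : nat) l'; exfalso.
  have : l.+1 * q <= l' * q by rewrite leq_mul2r ll orbT.
  by rewrite mulSn; lia.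
have : l'.+1 * q <= l * q by rewrite leq_mul2r ll orbT.
by rewrite mulSn; lia.
Qed.

Let unpos j : j < N -> exists y, pos y = j.
Proof.
move=> jN; have q0 : 0 < q by move: jN; rewrite /N; case: q.
have lm : j %/ q < m by rewrite ltn_divLR // mulnC.
exists (Ordinal (ltn_pmod j q0), Ordinal lm).
by rewrite /pos /= addnC -divn_eq.
Qed.

(* The arc of r vertices starting at position a of the cyclic arrangement pos,
   in which any q consecutive vertices lie in different parts. *)
Let arc r (a : 'I_N) : {set V} := [set y | (a <= pos y < a + r) || (pos y + N < a + r)].

(** Distinct vertices of one part are cyclically at least [q] apart, since [q] divides [N]. *)
Let arc_partial_transversal r a : r <= q -> partial_transversal (arc r a).
Proof.
move=> rq [i l] [i' l']; rewrite !inE /pos /= => h h' E; subst i'.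
congr pair; apply: val_inj => /=.
have mulq a' b' : a' <= b' -> a' * q <= b' * q by move=> ab; rewrite leq_mul2r ab orbT.
have := ltn_ord a; have := ltn_ord i; have := mulq _ _ (ltn_ord l).
have := mulq _ _ (ltn_ord l'); have : N = m * q by rewrite mulnC.
rewrite !mulSn => *.
have [ll|ll|//] := ltngtP (l : nat) l'; exfalso;
  have := mulq _ _ ll; rewrite mulSn; lia.
Qed.

(** The arcs that start at [y] or up to r-1 places before it contain [y]. The default of [insubd] is
    never taken, as the value is below [N]. *)
Let card_arcs r y : 0 < r -> r <= N -> r <= #|[set a | y \in arc r a]|.
Proof.
move=> r0 rN; have yN := pos_lt y; have N0 : 0 < N by apply: leq_trans rN.
pose f (t : 'I_r) : 'I_N :=
  insubd (Ordinal N0) (if t <= pos y then pos y - t else pos y + N - t).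
have fE (t : 'I_r) : f t = (if t <= pos y then pos y - t else pos y + N - t) :> nat.
  by rewrite val_insubd; have := ltn_ord t; case: ifP => //; case: ifP; lia.
have f_inj : injective f.
  move=> t t' /(congr1 val); rewrite /= !fE => E; apply: val_inj => /=; move: E.
  by have := ltn_ord t; have := ltn_ord t'; case: ifP; case: ifP; lia.
rewrite -[r in r <= _]card_ord -(card_imset _ f_inj); apply: subset_leq_card.
apply/subsetP => _ /imsetP[t _ ->]; rewrite !inE fE.
by have := ltn_ord t; case: ifP; lia.
Qed.

Let card_arc r a : 0 < r -> r <= N -> #|arc r a| = r.
Proof.
move=> r0 rN; have aN := ltn_ord a; have N0 : 0 < N by apply: leq_trans rN.
pose g t := if a + t < N then a + t else a + t - N.
have gN t : t < r -> g t < N by rewrite /g; case: ifP => //; lia.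
have [f fE] : exists f : 'I_r -> V, forall t, pos (f t) = g t.
  exact (@fin_all_exists 'I_r (fun=> V) (fun t y => pos y = g t)
    (fun t => unpos (gN _ (ltn_ord t)))).
have f_inj : injective f.
  move=> t t' /(congr1 pos); rewrite !fE /g => E; apply: val_inj => /=; move: E.
  by have := ltn_ord t; have := ltn_ord t'; case: ifP; case: ifP; lia.
rewrite -[RHS]card_ord -(card_imset _ f_inj); apply: eq_card => y.
rewrite inE; apply/idP/imsetP => [h|[t _ ->]].
  have yN := pos_lt y.
  have tr : (if a <= pos y then pos y - a else pos y + N - a) < r.
    by case: ifP; lia.
  exists (Ordinal tr) => //; apply: pos_inj; rewrite fE /g /=.
  by case: (leqP a (pos y)) => ay; case: ifP; lia.
by rewrite fE /g; have := ltn_ord t; case: ifP; lia.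
Qed.

(* Average over the relabellings g of the cyclic arrangement: for each g, at most
   r of the images of the arcs lie in F, and at least r lie in S. *)
Lemma star_bound_partial_transversal (x : V) r : 1 < m ->
  star_bound x partial_transversal r.
Proof.
move=> m1; have [->|r0] := posnP r; first exact: star_bound0.
move=> F S0 FT Fi ST0.
(* [S0] may contain other sets than partial transversals of size r, for which the count [hitE] would
   fail. *)
pose S := [set A in S0 | dinjectiveb fst A && (#|A| == r)].
suff: #|F| <= #|S|.
  by move/leq_trans; apply; apply/subset_leq_card/subsetP => A; rewrite inE => /andP[].
have ST A : partial_transversal A -> #|A| = r -> x \in A -> A \in S.
  move=> tA cA xA; rewrite inE ST0 //= cA eqxx andbT; exact/dinjectiveP.
have [rq|qr] := leqP r q; last first.
  suff -> : F = set0 by rewrite cards0.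
  apply/setP=> A; rewrite inE; apply/negP => /FT[tA cA].
  have := max_card (mem (fst @: A)); rewrite card_ord card_in_imset // cA leqNgt qr.
  by [].
(* This is where two vertices per part are required: r is at most [q], so 2r is at most [q * m]. *)
have rN : r.*2 <= N by rewrite /N -muln2 leq_mul.
have rN' : r <= N by lia.
pose H := [set g : {perm V} | fibred g].
pose hit (U : {set {set V}}) := \sum_(g in H) #|[set a | g @: arc r a \in U]|.
have imT (g : {perm V}) A : fibred g ->
    partial_transversal A -> partial_transversal (g @: A).
  move=> /fibredP fg tA _ _ /imsetP[y yA ->] /imsetP[z zA ->] /eqP.
  by rewrite fg => /eqP /(tA _ _ yA zA) ->.
have hitFS : hit F <= hit S.
  apply: leq_sum => g; rewrite inE => fg.
  apply: (@leq_trans r).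
    apply: card_circular_clique => // a b; rewrite !inE => aF bF ab.
    have /set0Pn[_ /setIP[/imsetP[y ya ->]]] := Fi _ _ aF bF.
    rewrite mem_imset; last exact: perm_inj.
    by move: ya; rewrite !inE; have := ltn_ord a; have := ltn_ord b;
      have := pos_lt y; lia.
  apply: leq_trans (card_arcs (g^-1%g x) r0 rN') _; apply: subset_leq_card.
  apply/subsetP => a; rewrite inE => ha; rewrite inE; apply: ST.
  - by apply: imT => //; apply: arc_partial_transversal.
  - by rewrite card_imset ?card_arc //; apply: perm_inj.
  - by apply/imsetP; exists (g^-1%g x); rewrite ?permKV.
(* By transitivity, as many relabellings carry an arc to a given member of [U] as fix the arc. Hence
   [hit U] is [#|U|] times a factor independent of [U], and comparing [hit] compares
   cardinalities. *)
pose w a := #|[set g in H | g @: arc r a == arc r a]|.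
have hitE (U : {set {set V}}) :
    (forall A, A \in U -> partial_transversal A /\ #|A| = r) ->
    hit U = #|U| * \sum_a w a.
  move=> UT; rewrite /hit.
  rewrite (eq_bigr (fun g : {perm V} =>
      \sum_a if g @: arc r a \in U then 1 else 0)) => [|g _]; last first.
    by rewrite -sum1dep_card big_mkcond.
  rewrite exchange_big big_distrr /=; apply: eq_bigr => a _; rewrite -big_mkcondr /=.
  have aT : partial_transversal (arc r a) by apply: arc_partial_transversal.
  have ac : #|arc r a| = r by apply: card_arc.
  rewrite (partition_big (fun g : {perm V} => g @: arc r a) (mem U)) /=; last first.
    by move=> g /andP[].
  rewrite -sum_nat_const; apply: eq_bigr => A AU.
  have [tA cA] := UT _ AU.
  (* Right multiplication by [h] maps the stabilizer of the arc onto the relabellings carrying it to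
     [A]. *)
  have [h fh hA] := transitive aT tA (etrans ac (esym cA)).
  rewrite sum1_card /w -[RHS](card_imset _ (mulIg h)); apply: eq_card => g.
  rewrite -topredE /= -andbA; apply/idP/imsetP => [/and3P[gH _ /eqP gA]|[g' + ->]].
    exists (g * h^-1)%g; last by rewrite mulgKV.
    rewrite !inE in gH *; rewrite fibredM ?fibredV // imsetM gA -hA.
    by rewrite -imsetM mulgV imset1 eqxx.
  rewrite !inE => /andP[fg /eqP ga].
  by rewrite fibredM // imsetM ga hA eqxx AU.
have w0 : 0 < \sum_a w a.
  have N0 : 0 < N by apply: leq_trans rN'.
  rewrite (bigD1 (Ordinal N0)) //= ltn_addr // card_gt0; apply/set0Pn; exists 1%g.
  rewrite !inE; apply/andP; split; first by apply/fibredP => y z; rewrite !perm1.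
  by rewrite imset1.
rewrite -(leq_pmul2r w0) -!hitE //.
  by move=> A; rewrite inE => /andP[_ /andP[/dinjectiveP tA /eqP]].
Qed.

End Multipartite.

(** * Reduction to equal complete components *)

Section Reduction.
Variables (T I : finType) (x0 x : T) (k : I -> nat) (istar : I).
Implicit Type c : I -> seq T.

(** Each component is a clique, so indexing the nonempty ones by [J] and their vertices by position
    turns independent sets into partial transversals, through the bijection [phi] onto the
    vertices. *)
Lemma star_bound_equal_parts c m r : 1 < m -> disjoint_seqs c ->
  (forall i, size (c i) <= (k i).*2.+1) ->
  (forall i, c i = [::] \/ size (c i) = m) -> x \in c istar ->
  star_bound x (indep x0 k c) r.
Proof.
move=> m1 [Uc Dc] ck cm xc.
pose J := [set i | c i != [::]].
have szJ i : i \in J -> size (c i) = m.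
  by rewrite inE; case: (cm i) => [->|].
pose V : finType := ('I_#|J| * 'I_m)%type.
pose phi (y : V) := nth x0 (c (enum_val y.1)) y.2.
have phi_in (y : V) : phi y \in c (enum_val y.1).
  by apply: mem_nth; rewrite szJ ?enum_valP.
have phi_fst (y z : V) i : phi y \in c i -> phi z \in c i -> y.1 = z.1.
  move=> /(Dc _ _ _ (phi_in y)) yi /(Dc _ _ _ (phi_in z)) zi.
  by apply: enum_val_inj; rewrite yi zi.
have phi_inj : injective phi.
  move=> y z E; have e1 : y.1 = z.1.
    by apply: (phi_fst _ _ (enum_val y.1)); rewrite -?E phi_in.
  have /eqP := E; rewrite /phi e1 nth_uniq ?szJ ?enum_valP // => /eqP e2.
  rewrite (surjective_pairing y) (surjective_pairing z) e1.
  by congr pair; apply: val_inj.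
have phi_ex y i : y \in c i -> exists z, phi z = y.
  move=> yi; have iJ : i \in J by rewrite inE; case: (c i) yi.
  have lm : index y (c i) < m by rewrite -(szJ i iJ) index_mem.
  by exists (enum_rank_in iJ i, Ordinal lm); rewrite /phi /= enum_rankK_in ?nth_index.
have [x' phix] := phi_ex _ _ xc.
have preK (A : {set T}) : (forall y, y \in A -> exists i, y \in c i) ->
    phi @: (phi @^-1: A) = A.
  move=> cA; apply/setP=> y; apply/imsetP/idP => [[z + ->]|yA]; first by rewrite inE.
  by have [i /phi_ex[z E]] := cA _ yA; exists z; rewrite ?inE E.
have imK (B : {set V}) : phi @^-1: (phi @: B) = B.
  by apply/setP=> y; rewrite inE mem_imset.
have indepT A : indep x0 k c A -> partial_transversal (phi @^-1: A).
  move=> [cA sA] y z; rewrite !inE => yA zA e1; apply/phi_inj.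
  have zi := phi_in z; have yi := phi_in y; rewrite e1 in yi.
  move: yA zA; rewrite -(nth_index x0 yi) -(nth_index x0 zi) => yA zA; congr nth.
  by apply: (iffLR (sep_complete x0 A (ck _)) (sA _) _ _ _ _ yA zA); rewrite index_mem.
have indepI (B : {set V}) : partial_transversal B -> indep x0 k c (phi @: B).
  move=> tB; split=> [_ /imsetP[y yB ->]|i].
    by exists (enum_val y.1); apply: phi_in.
  apply/sep_complete => // a b ac bc /imsetP[y yB Ey] /imsetP[z zB Ez].
  apply/eqP; rewrite -(nth_uniq x0 ac bc) // Ey Ez (inj_eq phi_inj); apply/eqP.
  by apply: tB => //; apply: (phi_fst _ _ i); rewrite -?Ey -?Ez mem_nth.
move=> F S FI Fi SI.
pose pre (A : {set T}) : {set V} := phi @^-1: A.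
have cardF : #|pre @: F| = #|F|.
  apply: card_in_imset => A B /FI[[cA _] _] /FI[[cB _] _].
  move/(congr1 (fun X : {set V} => phi @: X)).
  by rewrite /pre !preK.
rewrite -cardF; apply: leq_trans (leq_imset_card pre (mem S)).
apply: (star_bound_partial_transversal (x := x') (r := r) m1).
- move=> _ /imsetP[A /FI[IA cA] ->]; split; first exact: indepT.
  by rewrite -cA -{2}(preK A IA.1) card_imset.
- move=> _ _ /imsetP[A FA ->] /imsetP[B FB ->].
  have /set0Pn[y /setIP[yA yB]] := Fi _ _ FA FB.
  have [[cA _] _] := FI _ FA; have [i /phi_ex[z E]] := cA _ yA.
  by apply/set0Pn; exists z; rewrite !inE E yA.
- move=> B tB cB xB; apply/imsetP; exists (phi @: B); last by rewrite /pre imK.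
  apply: SI; first exact: indepI.
    by rewrite card_imset.
  by rewrite -phix mem_imset.
Qed.

(** Induction on the total number of vertices. The last hypothesis is kept by all the contractions:
    a component is emptied or stays at least as large as the star's component will be once complete,
    and while it is not complete its clique number k_i + 1 exceeds 2 [kstar] + 1. *)
Lemma star_bound_indep c r :
  (forall i, 0 < k i) -> disjoint_seqs c ->
  1 < size (c istar) -> nth x0 (c istar) 0 = x ->
  (forall i, i != istar -> c i = [::] \/
     minn (size (c istar)) (k istar).*2.+1 <= size (c i) /\
     ((k i).*2.+1 < size (c i) -> (k istar).*2 < k i)) ->
  star_bound x (indep x0 k c) r.
Proof.
move=> k0.
have [n] := ubnP (\sum_i size (c i)); elim: n => // n IHn in c r *.
rewrite ltnS => cn Dc cs cx cbig.
case: r => [|r]; first exact: star_bound0.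
have smaller i s : size s < size (c i) -> \sum_j size (upd c i s j) < n.
  by move=> sc; have := sum_upd c i s; lia.
have Dcut i a b : a <= b -> disjoint_seqs (upd c i (cut a b (c i))).
  by move=> ab; apply: upd_disjoint => //; [apply: cut_uniq (Dc.1 i)|apply: cut_subset].
have head a b : 0 < a <= b -> b <= size (c istar) -> nth x0 (cut a b (c istar)) 0 = x.
  by move=> /andP[a0 ab] bc; rewrite nth_cut ?ab // /skip a0.
(* The star's component shrinks first. Its cuts start after position 0, so [x] stays in front, and
   at least [(k istar).+1] vertices remain, hence two or more. *)
case: (ltnP (k istar).*2.+1 (size (c istar))) => cstar.
  have ks := k0 istar.
  apply: (indep_cycle (i0 := istar)) => //; apply: IHn;
    rewrite ?updE ?head ?size_cut ?smaller ?size_cut //; try apply: Dcut; try lia.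
    move=> i ii; rewrite updN //; case: (cbig i ii) => [|[h1 h2]]; [by left|right].
    by split=> //; lia.
  move=> i ii; rewrite updN //; case: (cbig i ii) => [|[h1 h2]]; [by left|right].
  by split=> //; lia.
have stepN i s : i != istar -> upd c i s istar = c istar.
  by move=> ii; rewrite updN // eq_sym.
have keep i s : i != istar ->
    s = [::] \/
      minn (size (c istar)) (k istar).*2.+1 <= size s /\ size s <= size (c i) ->
    forall j, j != istar -> upd c i s j = [::] \/
     minn (size (c istar)) (k istar).*2.+1 <= size (upd c i s j) /\
     ((k j).*2.+1 < size (upd c i s j) -> (k istar).*2 < k j).
  move=> ii si j jj; rewrite /upd; case: eqP => [->|_]; last exact: cbig.
  case: si => [|[s1 s2]]; [by left|right; split=> // h].
  case: (cbig i ii) => [ci|[_]]; last by apply; lia.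
  by move: s2; rewrite ci /=; lia.
(* Next come the other incomplete components: at least [(k i).+1] vertices remain after a cut, which
   is more than [(k istar).*2.+1]. *)
case: (pickP (fun i => (k i).*2.+1 < size (c i))) => [i ki|kc].
  have ii : i != istar by apply: contraTneq ki => ->; lia.
  have kk : (k istar).*2 < k i.
    by case: (cbig i ii) => [ci|[_]]; [rewrite ci in ki|apply].
  have := k0 i => ki0.
  apply: (indep_cycle (i0 := i)) => //; apply: IHn;
    rewrite ?stepN ?smaller ?size_cut //; try apply: Dcut; try lia.
    by apply: keep => //; right; rewrite size_cut; lia.
  by apply: keep => //; right; rewrite size_cut; lia.
(* All components are now complete; those larger than the star's lose one vertex or all of them. *)
case: (pickP (fun i => size (c istar) < size (c i))) => [i ci|cle].
  have ii : i != istar by apply: contraTneq ci => ->; rewrite ltnn.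
  have kci := kc i.
  apply: (indep_complete (i0 := i)) => //; first by lia.
    apply: IHn; rewrite ?stepN ?smaller ?size_cut //; try apply: Dcut; try lia.
    by apply: keep => //; right; rewrite size_cut; lia.
  apply: IHn; rewrite ?stepN ?smaller //=; try lia.
    by apply: upd_disjoint.
  by apply: keep => //; left.
apply: (star_bound_equal_parts cs) => // [i|i|].
- by have := kc i; lia.
- have [->|ii] := eqVneq i istar; first by right.
  case: (cbig i ii) => [|[h _]]; [by left|right].
  by have := cle i; lia.
- by rewrite -cx; apply: mem_nth; apply: leq_trans cs.
Qed.

End Reduction.

(** * Powers of cycles *)

Section CyclePowers.
Variable T : finType.
Implicit Types (G : sgraph T) (c : seq T).

Definition cycle_enum (x0 : T) G c : Prop :=
  [/\ uniq c, vset G =i c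
    & forall i j, i < j < size c ->
        adj G (nth x0 c i) (nth x0 c j) = (j == i.+1) || (i == 0) && (j.+1 == size c)].

(** The cycle is rotated so that the prescribed vertex comes first, the position the cuts of the
    star's component preserve. *)
Lemma is_cycle_enum x0 G x : is_cycle G -> x \in vset G ->
  exists c, [/\ cycle_enum x0 G c, 2 < size c & nth x0 c 0 = x].
Proof.
case=> n [n3 [f [f_inj fV fadj]]]; rewrite fV => /imsetP[i0 _ ->].
have n0 : 0 < n by lia.
pose g j := Ordinal (ltn_pmod (i0 + j) n0).
have gE j : j < n -> g j = (if i0 + j < n then i0 + j else i0 + j - n) :> nat.
  move=> jn; rewrite /g /=; case: ltnP => h; first by rewrite modn_small.
  have {1}-> : i0 + j = i0 + j - n + n by lia.
  by rewrite modnDr modn_small //; have := ltn_ord i0; lia.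
have g_inj i j : i < n -> j < n -> g i = g j -> i = j.
  move=> iN jN /(congr1 val).
  rewrite /= -[X in X = _]/(g i : nat) -[X in _ = X]/(g j : nat).
  by rewrite !gE //; have := ltn_ord i0; case: ifP; case: ifP; lia.
exists (mkseq (fun j => f (g j)) n); split; last 2 first.
- by rewrite size_mkseq.
- rewrite nth_mkseq //; congr f; apply: val_inj.
  by rewrite -[LHS]/(g 0 : nat) gE // addn0 ltn_ord.
split.
- rewrite map_inj_in_uniq ?iota_uniq // => i j; rewrite !mem_iota !add0n => iN jN.
  by move=> /f_inj; apply: g_inj.
- move=> y; rewrite fV; apply/imsetP/mapP => [[i _ ->]|[j _ ->]]; last by exists (g j).
  have [j jn ij] : exists2 j, j < n & i0 + j = i \/ i0 + j = i + n.
    have iN := ltn_ord i; have i0N := ltn_ord i0.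
    by case: (leqP i0 i) => h; [exists (i - i0)|exists (i + n - i0)]; lia.
  exists j; first by rewrite mem_iota.
  congr f; apply: val_inj; rewrite -[RHS]/(g j : nat) gE // -[LHS]/(i : nat).
  by have := ltn_ord i; case: ifP; lia.
- rewrite size_mkseq => i j ij; have [iN jN] : i < n /\ j < n by lia.
  rewrite !nth_mkseq // fadj /cycle_adj !gE //.
  by have := ltn_ord i0; case: ifP; case: ifP; lia.
Qed.

Section Enumerated.
Variables (x0 : T) (G : sgraph T) (c : seq T).
Hypothesis Gc : cycle_enum x0 G c.
Let n := size c.

Let c_ex y : y \in vset G -> exists2 i, i < n & nth x0 c i = y.
Proof. by case: Gc => _ -> _ /(nthP x0). Qed.

Let c_inj i j : i < n -> j < n -> nth x0 c i = nth x0 c j -> i = j.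
Proof. by case: Gc => Uc _ _ iN jN /eqP; rewrite nth_uniq // => /eqP. Qed.

Let walk0 y : walk G 0 y y.
Proof. by apply/walkP; exists [::]. Qed.

Let walkD d d' y z t : walk G d y z -> walk G d' z t -> walk G (d + d') y t.
Proof.
move=> /walkP[p [<- yp lp]] /walkP[p' [<- zp lp']]; apply/walkP.
by exists (p ++ p'); rewrite size_cat cat_path last_cat lp yp zp.
Qed.

Let walk1 y z : adj G y z -> walk G 1 y z.
Proof. by move=> yz; apply/walkP; exists [:: z]; rewrite /= yz. Qed.

Let walk_along i d : i + d < n -> walk G d (nth x0 c i) (nth x0 c (i + d)).
Proof.
elim: d => [|d IHd] idn; first by rewrite addn0.
rewrite -addn1; apply: walkD (IHd _) (walk1 _); first by lia.
by case: Gc => _ _ ->; rewrite -/n; lia.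
Qed.

(** Each step moves by one place around the cycle, so a walk is at least as long as one of the two
    arcs. The sum of truncated differences is the absolute value of i-j. *)
Let walk_ge p i j : i < n -> j < n -> path (adj G) (nth x0 c i) p ->
  last (nth x0 c i) p = nth x0 c j ->
  (i - j) + (j - i) <= size p \/ n <= size p + ((i - j) + (j - i)).
Proof.
elim: p i => [|y p IHp] i iN jN /=; first by move=> _ /c_inj E; have := E iN jN; lia.
move=> /andP[iy yp] lp.
have yV : y \in vset G by move: iy; rewrite adj_sym => /adj_vset.
have [l lN ly] := c_ex yV; subst y; have := IHp l lN jN yp lp.
case: Gc => _ _ adjE; have [il|li|il] := ltngtP i l.
- by move: iy; rewrite adjE ?il // -/n; lia.
- by move: iy; rewrite adj_sym adjE ?li // -/n; lia.
- by move: iy; rewrite il adj_irr.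
Qed.

(** The distance on the cycle is the length of the shorter arc: walking along it gives one bound,
    [walk_ge] the other. *)
Lemma gpower_cycle_adj k i j : i < j < size c ->
  gpower_adj G k (nth x0 c i) (nth x0 c j) = (j - i <= k) || (size c - (j - i) <= k).
Proof.
rewrite -/n => ij; pose d := minn (j - i) (n - (j - i)).
suff dE : dist G (nth x0 c i) (nth x0 c j) = Some d by rewrite /gpower_adj dE /d; lia.
apply/distP; split; last first.
  by move=> d' /walkP[p [<- ip lp]]; have := @walk_ge p i j _ _ ip lp; lia.
rewrite /d minnE; case: (leqP (j - i) (n - (j - i))) => h.
  have -> : j - i - (j - i - (n - (j - i))) = j - i by lia.
  by have := @walk_along i (j - i); rewrite subnKC; [apply; lia|lia].
(* The other arc is walked backwards, from j up to the last position, over the closing edge to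
   position 0, and on to i. *)
have -> : j - i - (j - i - (n - (j - i))) = n.-1 - j + 1 + i by lia.
rewrite walk_sym.
apply: walkD (walkD _ (walk1 (z := nth x0 c 0) _)) (walk_along (i := 0) (d := i) _).
- by have := @walk_along j (n.-1 - j); rewrite subnKC; [apply; lia|lia].
- by rewrite adj_sym; case: Gc => _ _ ->; rewrite -/n; lia.
- by lia.
Qed.

Lemma vset_gpower k : vset (gpower G k) = vset G. Proof. by []. Qed.

(** Members of a clique are pairwise within k on the cycle, so [card_circular_clique] applies with r
    = k+1. These upper bounds turn the hypothesis on cliques into conditions on sizes and
    exponents. *)
Lemma omega_gpower_cycle k : 0 < k -> omega (gpower G k) <= size c /\
  (k.*2.+1 < size c -> omega (gpower G k) <= k.+1).
Proof.
case: (Gc) => Uc cV _ k0.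
have card A : clique (gpower G k) A -> #|A| = #|[set i : 'I_n | nth x0 c i \in A]|.
  move=> /andP[/subsetP AV _].
  rewrite -(card_in_imset (f := fun i : 'I_n => nth x0 c i)) => [|i j _ _ E].
    apply: eq_card => y; apply/idP/imsetP => [yA|[i]]; last by rewrite inE => iA ->.
    by have [i iN E] := c_ex (AV y yA); exists (Ordinal iN); rewrite ?inE /= E.
  exact: val_inj (c_inj (ltn_ord i) (ltn_ord j) E).
split=> [|kn]; apply/bigmax_leqP => A clA; rewrite card //.
  by apply: leq_trans (max_card _) _; rewrite card_ord.
apply: card_circular_clique => // a b.
rewrite !inE => aA bA ab.
have bN : b < n by [].
case/andP: clA => _ /forall_inP/(_ _ aA)/forall_inP/(_ _ bA).
rewrite nth_uniq ?ltn_ord // ltn_eqF //= gpower_cycle_adj; last by rewrite ab.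
by rewrite -/n; lia.
Qed.

End Enumerated.

(** * Disjoint unions of cycle powers *)

Section Union.
Variables (I : finType) (Cyc : I -> sgraph T) (k : I -> nat) (G : sgraph T).
Variables (x0 : T) (c : I -> seq T).
Hypothesis G_union : is_disjoint_union (fun i => gpower (Cyc i) (k i)) G.
Hypothesis Cc : forall i, cycle_enum x0 (Cyc i) (c i).

Lemma disjoint_cycle_enums : disjoint_seqs c.
Proof.
case: G_union => disj _ _; split=> [i|i j y]; first by case: (Cc i).
have [_ <- _] := Cc i; have [_ <- _] := Cc j => yi yj.
by apply/eqP/negPn/negP => /disj /disjointFr/(_ yi); rewrite /= yj.
Qed.

Lemma independent_indep A : independent G A <-> indep x0 k c A.
Proof.
have [_ Dc] := disjoint_cycle_enums; case: G_union => _ GV Gadj; split.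
  move=> /andP[/subsetP AV /forall_inP indA]; split=> [y /AV|i a b ab aA bA].
    by rewrite GV => /bigcupP[i _]; have [_ -> _] := Cc i; exists i.
  have := forall_inP (indA _ aA) _ bA.
  rewrite Gadj => /existsP nadj.
  have := @gpower_cycle_adj x0 (Cyc i) (c i) (Cc i) (k i) a b ab.
  case: (gpower_adj _ _ _ _) / idP => [h|_]; first by case: nadj; exists i.
  by move=> E; lia.
move=> [cA sA]; apply/andP; split.
  apply/subsetP => y /cA[i yi]; rewrite GV; apply/bigcupP; exists i => //.
  by rewrite vset_gpower; have [_ -> _] := Cc i.
apply/forall_inP => y yA; apply/forall_inP => z zA.
rewrite Gadj; apply/existsP => -[i yz].
have yi : y \in c i by have [_ <- _] := Cc i; apply: (gpower_vset yz).
have zi : z \in c i.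
  have [_ <- _] := Cc i.
  by apply: (@gpower_vset _ _ (k i) z y); rewrite gpower_sym.
have [a aN ya] : exists2 a, a < size (c i) & nth x0 (c i) a = y by apply/nthP.
have [b bN zb] : exists2 b, b < size (c i) & nth x0 (c i) b = z by apply/nthP.
subst y z.
have adjE := @gpower_cycle_adj x0 (Cyc i) (c i) (Cc i) (k i).
rewrite /= in yz; have [ab|ba|ab] := ltngtP a b.
- by have := sA i a b _ yA zA; have := adjE a b; rewrite yz; lia.
- by have := sA i b a _ zA yA; have := adjE b a; rewrite gpower_sym yz; lia.
- by move: yz; rewrite ab gpower_irr.
Qed.

End Union.
End CyclePowers.

Theorem theorem5 (T : finType) (s : nat) (kstar : nat) (k : 'I_s -> nat)
    (Cstar : sgraph T) (C : 'I_s -> sgraph T) (G : sgraph T) (r : nat)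
    (kstar_gt0 : 0 < kstar) (k_gt0 : forall i : 'I_s, 0 < k i)
    (Cstar_cycle : is_cycle Cstar) (C_cycle : forall i : 'I_s, is_cycle (C i))
    (G_union : is_disjoint_union
       (fun o : option 'I_s =>
          match o with
          | None => gpower Cstar kstar
          | Some i => gpower (C i) (k i)
          end) G)
    (r_bounds : 1 <= r <= alpha G)
    (omega_gt : forall i : 'I_s, 2 * kstar + 1 < omega (gpower (C i) (k i))) :
  EKR G r /\
  (forall x : T, x \in vset Cstar ->
     largest_intersecting (indep_family G r) (star (indep_family G r) x)).
Proof.
(* All components are indexed uniformly, with [None] for the one containing the star's center. *)
pose Cyc o := if o is Some i then C i else Cstar.
pose kk o := if o is Some i then k i else kstar.
have Cyc_cycle o : is_cycle (Cyc o) by case: o.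
have kk_gt0 o : 0 < kk o by case: o.
have GU : is_disjoint_union (fun o => gpower (Cyc o) (kk o)) G.
  case: G_union => disj GV Gadj; split=> [i j ij|//|x y].
  - by have := disj i j ij; case: i j {ij} => [i|] [j|].
  - by rewrite GV; apply: eq_bigr => -[].
  - by rewrite Gadj; apply: eq_existsb => -[].
have vset_ex o : exists x, x \in vset (Cyc o).
  case: (Cyc_cycle o) => n [n3 [f [_ -> _]]].
  have n0 : 0 < n by apply: leq_trans n3.
  by exists (f (Ordinal n0)); apply: imset_f.
have main x : x \in vset Cstar ->
    largest_intersecting (indep_family G r) (star (indep_family G r) x).
  move=> xC.
  have enum o : exists c,
      [/\ cycle_enum x (Cyc o) c, 2 < size c & o = None -> nth x c 0 = x].
    have [y yC yx] : exists2 y, y \in vset (Cyc o) & o = None -> y = x.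
      by case: o => [i|]; [have [y] := vset_ex (Some i); exists y|exists x].
    have [c [cE c2 cy]] := is_cycle_enum x (Cyc_cycle o) yC.
    by exists c; split=> // /yx; rewrite cy.
  have [c cP] := fin_all_exists enum.
  have Cc o : cycle_enum x (Cyc o) (c o) by case: (cP o).
  have bound : star_bound x (indep x kk c) r.
    apply: (star_bound_indep (istar := None)) => //.
    - exact: disjoint_cycle_enums GU Cc.
    - by case: (cP None) => _ h _; apply: ltnW.
    - by case: (cP None) => _ _; apply.
    - case=> [i|//] _; right.
      (* The clique number exceeds 2 [kstar] + 1; so does the number of vertices, and in the
         incomplete case k_i + 1, that is, k_i > 2 [kstar]. *)
      have [h1 h2] := omega_gpower_cycle (Cc (Some i)) (k_gt0 i).
      by have := omega_gt i; move: h1 h2; rewrite /= => h1 h2 h3; split=> [|/h2]; lia.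
  have ind A : independent G A <-> indep x kk c A := independent_indep GU Cc A.
  split.
  - by apply/subsetP => A; rewrite inE => /andP[].
  - move=> A B; rewrite !inE => /andP[_ xA] /andP[_ xB].
    by apply/set0Pn; exists x; rewrite inE xA xB.
  - move=> F /subsetP FI Fi; apply: bound => // A.
      by move=> /FI; rewrite inE => /andP[/ind IA /eqP].
    by move=> /ind IA cA xA; rewrite !inE IA cA eqxx xA.
split=> //; have [x xC] := vset_ex None; exists x; last exact: main.
case: GU => _ -> _; apply/bigcupP; by exists None.
Qed.
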